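(* Let $S$ be a range set possessing at least two elements. Let $R$ be an integral domain, and let $(X,d)$ be an $S$-valued ultrametric space. Then there exist an $S$-valued ultra-normed $R$-module $(V,\|\cdot\|)$ and an isometric embedding $I: X\to V$ (where $V$ carries the metric $(x,y)\mapsto \|x-y\|$) such that (1) $I(X)$ is closed in $V$; (2) $I(X)$ is $R$-independent in $V$. Moreover, if $(X,d)$ is complete, then $(V,\|\cdot\|)$ can be chosen to be complete as a metric space.
   Context: A range set is a set $S\subseteq[0,\infty)$ with $0\in S$. A metric $d$ on $X$ is an ultrametric if $d(x,y)\le d(x,z)\lor d(z,y)$ for all $x,y,z$, where $\lor$ denotes the maximum; it is $S$-valued if $d(X^2)\subseteq S$. For a commutative ring $R$ and an $R$-module $V$ with zero $0_V$, a function $\|\cdot\|:V\to[0,\infty)$ is an ultra-norm on $V$ if (i) $\|x\|=0$ iff $x=0_V$; (ii) $\|-x\|=\|x\|$ for all $x\in V$; (iii) $\|x+y\|\le\|x\|\lor\|y\|$ for all $x,y\in V$. The pair $(V,\|\cdot\|)$ is then called an ultra-normed $R$-module; it is regarded as an ultrametric space with the metric $\|x-y\|$, and it is $S$-valued if this metric is $S$-valued. A subset $A\subseteq V$ is $R$-independent if for every finite set of distinct elements $f_1,\dots,f_n\in A$ and all $N_1,\dots,N_n\in R$, $\sum_{i=1}^n N_if_i=0_V$ implies $N_i=0_R$ for all $i$. *)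

(* Defs.v *)
From HB Require Import structures.
From mathcomp Require Import all_boot all_order all_algebra.
From mathcomp Require Import all_classical all_reals all_analysis.

Set Implicit Arguments.
Unset Strict Implicit.
Unset Printing Implicit Defensive.

Import Order.TTheory GRing.Theory Num.Theory.

Local Open Scope classical_set_scope.
Local Open Scope ring_scope.

Definition range_set (K : realType) (S : set K) : Prop :=
  S `<=` [set s | 0 <= s] /\ S 0.

Definition ultrametric (K : realType) (T : metricType K) : Prop :=
  forall x y z : T, mdist x y <= Num.max (mdist x z) (mdist z y).

Definition valued_in (K : realType) (S : set K) (T : metricType K) : Prop :=
  forall x y : T, S (mdist x y).

(* The library's [completeType] and [cvg] require a pointed type; this is the
   same condition without a base point, so that the empty space is allowed. *)
Definition complete_space (T : uniformType) : Prop :=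
  forall F : set_system T, ProperFilter F -> cauchy F -> exists l : T, F --> l.

(* No compatibility between the norm and scalar multiplication is required. *)
Record ultraNormedModule (K : realType) (R : comPzRingType) :=
    UltraNormedModule {
  unm_sort :> lmodType R ;
  unorm : unm_sort -> K ;
  unorm_ge0 : forall x, 0 <= unorm x ;
  unorm_eq0 : forall x, unorm x = 0 <-> x = 0 ;
  unormN : forall x, unorm (- x) = unorm x ;
  unormD : forall x y, unorm (x + y) <= Num.max (unorm x) (unorm y)
}.

(* An alias carrying the metric: a single HB structure that is both a metric
   space over [K] and a module over [R <> K] would clash with the library's
   topological modules, whose scalars and metric share one ring. *)
Definition metric_of (K : realType) (R : comPzRingType)
  (V : ultraNormedModule K R) : Type := V.

Section metric_of.
Context (K : realType) (R : comPzRingType) (V : ultraNormedModule K R).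

Definition udist (x y : V) : K := unorm (x - y).

Lemma udistxx x : udist x x = 0.
Proof. by rewrite /udist subrr; apply/unorm_eq0. Qed.

Lemma udist_positivity x y : udist x y = 0 -> x = y.
Proof. by move=> /unorm_eq0/eqP; rewrite subr_eq0 => /eqP. Qed.

Lemma udist_sym x y : udist x y = udist y x.
Proof. by rewrite /udist -unormN opprB. Qed.

Lemma udist_triangle y x z : udist x z <= udist x y + udist y z.
Proof.
rewrite /udist -(subrKA y); apply: le_trans (unormD _ _) _.
by rewrite ge_max lerDl lerDr !unorm_ge0.
Qed.

HB.instance Definition _ := Choice.on (metric_of V).

HB.instance Definition _ := @isMetric.Build K (metric_of V) udist
  udistxx udist_positivity udist_sym udist_triangle.

Lemma mdist_unorm (x y : V) :
  mdist (x : metric_of V) (y : metric_of V) = unorm (x - y).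
Proof. by []. Qed.

End metric_of.

Definition independent (R : comPzRingType) (V : lmodType R) (A : set V) : Prop :=
  forall (n : nat) (f : 'I_n -> V) (N : 'I_n -> R),
    injective f -> (forall i, A (f i)) ->
    \sum_(i < n) N i *: f i = 0 -> forall i, N i = 0.

Definition isometric_embedding (K : realType) (X Y : metricType K)
    (I : X -> Y) : Prop :=
  forall x y : X, mdist (I x) (I y) = mdist x y.

(* Main.v *)
Require Import Defs.
From HB Require Import structures.
From mathcomp Require Import all_boot all_order all_algebra.
From mathcomp Require Import all_classical all_reals all_analysis.

Set Implicit Arguments.
Unset Strict Implicit.
Unset Printing Implicit Defensive.

Import Order.TTheory GRing.Theory Num.Theory.

Local Open Scope classical_set_scope.
Local Open Scope ring_scope.

(* Add to X a point o at distance h(y) = max(d(x0, y), s0) from y, with s0 > 0 in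
   S.  A finite combination of points of X is encoded by the function sending
   an open ball B(y, r) not containing o to the sum of the coefficients of the
   points lying in it, and its norm is the largest radius at which this function
   is not zero.  This radius is a distance between two points of the support, or
   between one of them and o, hence it belongs to S, and d(x, y) is recovered as
   the norm of x - y.  Since every point is at distance at least s0 from o, a
   combination approximated closely enough by points of X is a point of X, so
   that X is closed in the span.  If X is complete, the span is replaced with its
   completion, which consists of the functions that agree, above every positive
   radius, with a finite combination; X, being complete, is closed there, and it
   stays independent. *)

(** * Minima of finite lists and points of a closure *)

Lemma seq_min_ex d (T : orderType d) (s : seq T) (P : pred T) x0 :
  x0 \in s -> P x0 ->
  exists x, [/\ x \in s, P x & forall y, y \in s -> P y -> (x <= y)%O].
Proof.
move=> x0s Px0; have x0' : x0 \in [seq x <- s | P x] by rewrite mem_filter Px0.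
case: (@Order.TotalTheory.arg_minP _ _ _ (SeqSub x0') xpredT val isT).
move=> [x /= xs] _ xmin; move: (xs); rewrite mem_filter => /andP[Px xs'].
exists x; split=> // y ys Py.
have y' : y \in [seq x <- s | P x] by rewrite mem_filter Py.
exact: (xmin (SeqSub y')).
Qed.

Lemma pos_lower_bound (K : realType) (s : seq K) :
  exists2 e : K, 0 < e & forall x, x \in s -> 0 < x -> e <= x.
Proof.
have [] := @seq_min_ex _ K (1 :: s) (fun x => 0 < x) 1; rewrite ?mem_head//.
move=> e [_ e0 emin]; exists e => // x xs; apply: emin.
by rewrite in_cons xs orbT.
Qed.

Lemma closure_mdist (K : realType) (T : metricType K) (A : set T)
    (u : T) (e : K) :
  closure A u -> 0 < e -> exists2 v, A v & mdist u v < e.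
Proof.
move=> Au e0; have [v [Av]] := Au _ (nbhsx_ballx u e e0).
by rewrite ballEmdist => uv; exists v.
Qed.

(** * Functions of a centre and a radius whose radii are bounded *)

Section hat_functions.
Context (K : realType) (R : comNzRingType) (X : metricType K).
Local Notation F := (X -> K -> R^o).
Implicit Types (u v : F) (t r e : K) (x y z : X) (l : seq (R * X)).

(** This is the bound [t] on the future norm of [u]. Positivity of the radii is part of it, so that
    [supp_le 0 u] forces [u = 0]. *)
Definition supp_le t u := forall y r, u y r != 0 -> 0 < r <= t.

Lemma supp_leW t t' u : t <= t' -> supp_le t u -> supp_le t' u.
Proof. by move=> tt' ut y r /ut/andP[-> /le_trans->]. Qed.

Lemma supp_le_out t u y r : supp_le t u -> ~~ (0 < r <= t) -> u y r = 0.
Proof. by move=> ut ur; apply/eqP; apply: contraNT ur; exact: ut. Qed.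

Lemma supp_le_ne0 t u : supp_le t u -> u != 0 -> 0 < t.
Proof.
move=> ut; rewrite ltNge; apply: contra => t0; apply/eqP/funext => y.
apply/funext => r; apply: (supp_le_out y ut).
by apply/negP => /andP[/lt_le_trans h /h]; rewrite ltNge t0.
Qed.

Lemma supp_le0 t : supp_le t 0.
Proof. by move=> y r; rewrite eqxx. Qed.

Lemma supp_leZD t (a : R) u v :
  supp_le t u -> supp_le t v -> supp_le t (a *: u + v).
Proof.
move=> ut vt y r; apply: contraNT => yr; apply/eqP.
have -> : (a *: u + v) y r = a * u y r + v y r by [].
by rewrite (supp_le_out y ut)// (supp_le_out y vt)// mulr0 addr0.
Qed.

Lemma supp_leD t u v : supp_le t u -> supp_le t v -> supp_le t (u + v).
Proof. by move=> ut vt; rewrite -[u]scale1r; exact: supp_leZD. Qed.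

Lemma supp_leN t u : supp_le t u -> supp_le t (- u).
Proof.
move=> ut; rewrite -scaleN1r -[_ *: _]addr0.
by apply: supp_leZD => //; exact: supp_le0.
Qed.

(* [h y] plays the role of the distance from [y] to a point added to [X], which
   becomes the zero of the module. *)
Context (h : X -> K).

(* [hat x y r] tests whether [x] lies in the open ball of centre [y] and radius
   [r], the balls containing the added point being discarded. *)
Definition hat x : F := fun y r => (mdist x y < r <= h y)%R%:R.

(** * Finite combinations and their critical radii *)

Definition comb l : F := \sum_(p <- l) p.1 *: hat p.2.

Lemma combE l y r :
  comb l y r = \sum_(p <- l) p.1 * (mdist p.2 y < r <= h y)%R%:R.
Proof. by rewrite /comb !fct_sumE. Qed.

Lemma comb_ne0 l y r :
  comb l y r != 0 -> exists2 p, p \in l & mdist p.2 y < r <= h y.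
Proof.
move=> lyr; apply: contrapT => no; move/eqP: lyr; apply.
rewrite combE big_seq big1// => p pl; case: (boolP (_ < _ <= _)).
  by move=> pyr; case: no; exists p.
by rewrite mulr0.
Qed.

Lemma comb_gt0 l y r : comb l y r != 0 -> 0 < r.
Proof. by case/comb_ne0=> p _ /andP[/(le_lt_trans (mdist_ge0 _ _))]. Qed.

Lemma combZD (a : R) l l' :
  a *: comb l + comb l' = comb ([seq (a * p.1, p.2) | p <- l] ++ l').
Proof.
rewrite /comb big_cat big_map scaler_sumr; congr (_ + _).
by apply: eq_bigr => p _; rewrite scalerA.
Qed.

Definition critical l : seq K :=
  [seq h p.2 | p <- l] ++ [seq mdist p.2 q.2 | p <- l, q <- l].

Lemma critical_h l p : p \in l -> h p.2 \in critical l.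
Proof.
move=> pl; rewrite mem_cat; apply/orP; left.
exact: (map_f (fun p : R * X => h p.2)).
Qed.

Lemma critical_mdist l p q :
  p \in l -> q \in l -> mdist p.2 q.2 \in critical l.
Proof.
move=> pl ql; rewrite mem_cat; apply/orP; right.
exact: (allpairs_f (fun p q : R * X => mdist p.2 q.2)).
Qed.

(** * Ultrametric balls and the top radius of a combination *)

Hypothesis hX : ultrametric X.
Hypothesis h_gt0 : forall x, 0 < h x.
Hypothesis h_max : forall x y, h y <= Num.max (mdist x y) (h x).
Hypothesis mdist_h : forall x y, mdist x y <= Num.max (h x) (h y).

(** Every point of an ultrametric open ball is a centre of it. *)
Lemma ball_recenter x y z r :
  mdist x y < r -> (mdist z y < r) = (mdist z x < r).
Proof.
move=> xy; apply/idP/idP => zr.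
  by rewrite (le_lt_trans (hX _ _ y))// gt_max zr metric_sym.
by rewrite (le_lt_trans (hX _ _ x))// gt_max zr.
Qed.

(** The balls of radius [r] about [x] and [y] coincide, so both or neither contain the added
    point. *)
Lemma h_recenter x y r : mdist x y < r -> (r <= h y) = (r <= h x).
Proof.
move=> xy; apply/idP/idP => rh.
  by have := le_trans rh (h_max x y); rewrite le_max leNgt xy.
by have := le_trans rh (h_max y x); rewrite le_max leNgt metric_sym xy.
Qed.

Lemma comb_recenter l x y r : mdist x y < r -> comb l y r = comb l x r.
Proof.
move=> xy; rewrite !combE; apply: eq_bigr => p _.
by rewrite (ball_recenter _ xy) (h_recenter xy).
Qed.

(* [r |-> comb l z r], for a centre [z] in [l], is constant between consecutive
   critical values. *)
Lemma comb_jump l y r : comb l y r != 0 ->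
  exists s, [/\ s \in critical l, r <= s & exists z, comb l z s != 0].
Proof.
move=> lyr; have [p pl /andP[py rh]] := comb_ne0 lyr.
rewrite (comb_recenter _ py) in lyr; rewrite (h_recenter py) in rh.
have [s [sl rs smin]] := seq_min_ex (critical_h pl) rh.
exists s; split=> //; exists p.2; move: lyr; congr (_ != 0); rewrite !combE.
rewrite !big_seq; apply: eq_bigr => q ql.
rewrite rh (smin _ (critical_h pl) rh) !andbT; congr (_ * _%:R).
congr (nat_of_bool _); apply/idP/idP => qp; first exact: lt_le_trans rs.
rewrite ltNge; apply/negP => /(smin _ (critical_mdist ql pl)).
by rewrite leNgt qp.
Qed.

(** By [comb_jump], each radius of the support lies below a critical one of the support, and there
    are finitely many of these. *)
Lemma comb_top l : comb l != 0 ->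
  exists s, [/\ s \in critical l, exists z, comb l z s != 0 &
                supp_le s (comb l)].
Proof.
move=> l0; have [y [r lyr]] : exists y r, comb l y r != 0.
  apply: contrapT => no; move/eqP: l0; apply; apply/funext => y.
  apply/funext => r; apply/eqP/negPn/negP => lyr; apply: no.
  by exists y, r.
have [s0 [s0l _ s0z]] := comb_jump lyr.
(* The dual order [K^d] turns the minimum of [seq_min_ex] into a maximum. *)
pose P (s : K^d) : bool := `[< exists z, comb l z s != 0 >].
have [s [sl /asboolP sz smax]] :=
  @seq_min_ex _ K^d (critical l) P s0 s0l (asboolT s0z).
exists s; split=> // z t lzt; rewrite (comb_gt0 lzt) /=.
have [s' [s'l ts' s'z]] := comb_jump lzt.
exact: le_trans ts' (smax s' s'l (asboolT s'z)).
Qed.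

(** A ball of radius above [mdist x y] contains both points or neither. At radius [mdist x y], the
    balls about [x] and [y] separate them, and by [mdist_h] one of these avoids the added point. *)
Lemma supp_le_hatB x y t :
  0 <= t -> supp_le t (hat x - hat y) <-> mdist x y <= t.
Proof.
move=> t0; split=> [xyt|xyt z r].
  have [->|] := eqVneq x y; first by rewrite mdistxx.
  rewrite -mdist_gt0 => xy0.
  have : (hat x - hat y) x (mdist x y) != 0 \/
         (hat x - hat y) y (mdist x y) != 0.
    rewrite !fctE /hat !mdistxx (metric_sym y) ltxx xy0 /= subr0 sub0r oppr_eq0.
    have := mdist_h x y; rewrite le_max.
    by case/orP => ->; [left|right]; rewrite oner_neq0.
  by case=> /xyt/andP[].
rewrite !fctE /hat; apply: contraNT; rewrite negb_and -ltNge => rout.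
have [r0|r0] := leP r 0.
  have nlt w : (mdist w z < r) = false.
    by apply/negbTE; rewrite -leNgt (le_trans r0)// mdist_ge0.
  by rewrite !nlt subrr.
move: rout; rewrite r0 /= => tr; rewrite !(metric_sym _ z).
by rewrite (@ball_recenter x y) ?subrr// (le_lt_trans xyt).
Qed.

(** * The module of approximable functions and its norm *)

Context (S : set K) (E : set K).
Hypothesis hS : range_set S.
Hypothesis hXS : valued_in S X.
Hypothesis hSh : forall x, S (h x).
Hypothesis E_small : forall r, 0 < r -> exists2 e, E e & e < r.

Lemma critical_valued l s : s \in critical l -> S s.
Proof.
by rewrite mem_cat => /orP[/mapP[p _ ->]|/allpairsP[[p q] [_ _ ->]]].
Qed.

(* [E = [set 0]] gives the span of the [hat x], and [E = [set e | 0 < e]] its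
   completion. *)
Definition approx : {pred F} :=
  fun u => `[< forall e, E e -> exists l, supp_le e (u - comb l) >].

Lemma approx_submod_closed : submod_closed approx.
Proof.
split=> [|a u v /asboolP uE /asboolP vE]; apply/asboolP => e Ee.
  by exists [::]; rewrite /comb big_nil subrr; exact: supp_le0.
have [l ul] := uE e Ee; have [l' vl'] := vE e Ee.
exists ([seq (a * p.1, p.2) | p <- l] ++ l').
by rewrite -combZD opprD addrACA -scalerBr; exact: supp_leZD.
Qed.

HB.instance Definition _ := GRing.isSubmodClosed.Build R F approx
  approx_submod_closed.

Definition hat_module := {u : F | approx u}.

HB.instance Definition _ := [isSub of hat_module for @sval F approx].
HB.instance Definition _ := [Choice of hat_module by <:].
HB.instance Definition _ := [SubChoice_isSubLmodule of hat_module by <:].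

Lemma val_hatD (u v : hat_module) : val (u + v) = val u + val v.
Proof. by []. Qed.

Lemma val_hatB (u v : hat_module) : val (u - v) = val u - val v.
Proof. by []. Qed.

Lemma hat_approx x : approx (hat x).
Proof.
apply/asboolP => e _; exists [:: (1, x)].
by rewrite /comb big_seq1 scale1r subrr; exact: supp_le0.
Qed.

Lemma approx_gt0 u y r : approx u -> u y r != 0 -> 0 < r.
Proof.
move=> /asboolP uE; have [e Ee _] := E_small ltr01; have [l ul] := uE e Ee.
apply: contraNT => r0.
have -> : u y r = (u - comb l) y r + comb l y r by rewrite !fctE subrK.
rewrite (supp_le_out y ul) ?negb_and ?r0// add0r.
by apply: contraNT r0; exact: comb_gt0.
Qed.

(** Approximation within [e < r] changes nothing at radii from [r] on. The top radius of [u] is thus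
    that of a finite combination, hence a critical value, and the completion takes no norm outside
    [S]. *)
Lemma approx_top u : approx u -> u != 0 ->
  exists s, [/\ S s, exists z, u z s != 0 & supp_le s u].
Proof.
move=> uA u0; have [y [r uyr]] : exists y r, u y r != 0.
  apply: contrapT => no; move/eqP: u0; apply; apply/funext => y.
  apply/funext => r; apply/eqP/negPn/negP => uyr; apply: no.
  by exists y, r.
have r0 := approx_gt0 uA uyr; have [e Ee er] := E_small r0.
move/asboolP: uA => /(_ e Ee)[l ul].
have eqC z t : r <= t -> comb l z t = u z t.
  move=> rt; apply/esym/eqP; rewrite -subr_eq0; apply/eqP.
  apply: (supp_le_out z ul).
  by rewrite negb_and -ltNge (lt_le_trans er rt) orbT.
have lyr : comb l y r != 0 by rewrite eqC.
have l0 : comb l != 0 by apply: contraNneq lyr => ->.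
have [s [sl [z sz] ls]] := comb_top l0.
have /andP[_ rs] := ls _ _ lyr.
exists s; split; first exact: critical_valued sl.
  by exists z; rewrite -eqC.
rewrite -[u](subrK (comb l)); apply: supp_leD => //.
by apply: supp_leW ul; rewrite ltW// (lt_le_trans er rs).
Qed.

(** The infimum makes sense for every [u]. On [approx] it is attained, and is the top radius of the
    support, or 0 when [u = 0]. *)
Definition supp_norm u : K := inf [set t | 0 <= t /\ supp_le t u].

Lemma supp_norm_least u s : 0 <= s ->
  (forall t, 0 <= t -> supp_le t u <-> s <= t) -> supp_norm u = s.
Proof.
move=> s0 sP.
have sA : [set t | 0 <= t /\ supp_le t u] s by split=> //; apply/sP.
apply/eqP; rewrite eq_le; apply/andP; split.
  by apply: ge_inf => //; exists 0 => t [].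
by apply: lb_le_inf => [|t [t0 /(sP _ t0)]]; first by exists s.
Qed.

Lemma supp_normP u : approx u ->
  [/\ S (supp_norm u), 0 <= supp_norm u &
      forall t, 0 <= t -> supp_le t u <-> supp_norm u <= t].
Proof.
move=> uA.
suff [s [Ss s0 sP]] : exists s, [/\ S s, 0 <= s &
    forall t, 0 <= t -> supp_le t u <-> s <= t].
  by rewrite (supp_norm_least s0 sP).
have [-> |u0] := eqVneq u 0.
  by exists 0; split=> [|//|t t0]; [exact: hS.2|split=> // _; exact: supp_le0].
have [s [Ss [z sz] us]] := approx_top uA u0.
exists s; split=> [//||t t0]; first exact: hS.1.
split=> [ut|st]; last exact: supp_leW us.
by have /andP[] := ut _ _ sz.
Qed.

Lemma supp_norm_ge0 (u : hat_module) : 0 <= supp_norm (val u).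
Proof. by have [] := supp_normP (valP u). Qed.

Lemma supp_norm_leP (u : hat_module) t :
  0 <= t -> supp_le t (val u) <-> supp_norm (val u) <= t.
Proof. by move=> t0; have [_ _ /(_ t t0)] := supp_normP (valP u). Qed.

Lemma supp_norm_supp (u : hat_module) : supp_le (supp_norm (val u)) (val u).
Proof. by apply/(supp_norm_leP _ (supp_norm_ge0 u)). Qed.

Lemma supp_norm_eq0 (u : hat_module) : supp_norm (val u) = 0 <-> u = 0.
Proof.
split=> [u0|->].
  apply/val_inj/eqP/negPn/negP; rewrite raddf0 => u_ne0.
  by have := supp_le_ne0 (@supp_norm_supp u) u_ne0; rewrite u0 ltxx.
rewrite raddf0; apply: supp_norm_least => // t t0.
by split=> // _; exact: supp_le0.
Qed.

Lemma supp_normN (u : hat_module) : supp_norm (val (- u)) = supp_norm (val u).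
Proof.
have le (v : hat_module) : supp_norm (val (- v)) <= supp_norm (val v).
  apply/(supp_norm_leP _ (supp_norm_ge0 v)); rewrite raddfN.
  exact/supp_leN/supp_norm_supp.
by apply/eqP; rewrite eq_le le -{1}(opprK u) le.
Qed.

Lemma supp_normD (u v : hat_module) :
  supp_norm (val (u + v)) <= Num.max (supp_norm (val u)) (supp_norm (val v)).
Proof.
apply/supp_norm_leP; first by rewrite le_max supp_norm_ge0.
rewrite val_hatD; apply: supp_leD.
- by apply: supp_leW (@supp_norm_supp u); rewrite le_max lexx.
- by apply: supp_leW (@supp_norm_supp v); rewrite le_max lexx orbT.
Qed.

Definition hat_unm : ultraNormedModule K R :=
  @UltraNormedModule K R hat_module (fun u : hat_module => supp_norm (val u))
    supp_norm_ge0 supp_norm_eq0 supp_normN supp_normD.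

(** * The embedding and the independence of its image *)

Definition hat_embed (x : X) : metric_of hat_unm :=
  exist approx (hat x) (hat_approx x).

Lemma hat_mdist_leP (u v : metric_of hat_unm) t :
  0 <= t ->
  supp_le t (val (u : hat_module) - val (v : hat_module)) <-> mdist u v <= t.
Proof.
by move=> t0; rewrite -val_hatB; exact: supp_norm_leP.
Qed.

Lemma hat_unm_valued : valued_in S (metric_of hat_unm).
Proof. by move=> u v; have [] := supp_normP (valP ((u : hat_module) - v)). Qed.

Lemma hat_embed_isometric : isometric_embedding hat_embed.
Proof.
move=> x y; apply: supp_norm_least => [|t t0]; first exact: mdist_ge0.
exact: supp_le_hatB.
Qed.

Lemma hat_mdist_supp (u v : metric_of hat_unm) :
  supp_le (mdist u v) (val (u : hat_module) - val (v : hat_module)).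
Proof. by apply/(hat_mdist_leP _ _ (mdist_ge0 _ _)). Qed.

Lemma hat_mdist_agree (u v : metric_of hat_unm) y r :
  mdist u v < r -> val (u : hat_module) y r = val (v : hat_module) y r.
Proof.
move=> uvr; apply/eqP; rewrite -subr_eq0; apply/eqP.
apply: (supp_le_out y (@hat_mdist_supp u v)).
by rewrite negb_and -ltNge uvr orbT.
Qed.

(** A small enough ball about [x i] contains neither the other points [x j] nor the added point.
    Evaluation at this ball is linear and isolates [N i]. *)
Lemma hat_independent : independent (range hat_embed : set hat_unm).
Proof.
move=> n f N f_inj f_range sum0 i.
have /choice[x xE] j : exists y, hat_embed y = f j.
  by have [y _ <-] := f_range j; exists y.
have [e e0 eP] :=
  pos_lower_bound (h (x i) :: [seq mdist (x j) (x i) | j <- enum 'I_n]).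
have ev : \sum_(j < n) N j * hat (x j) (x i) e = 0.
  transitivity (val (\sum_(j < n) N j *: f j : hat_module) (x i) e).
    by rewrite raddf_sum !fct_sumE; apply: eq_bigr => j _; rewrite -xE.
  by rewrite sum0.
rewrite -[RHS]ev (bigD1 i)//= big1 => [|j ji]; rewrite /hat.
  by rewrite addr0 mdistxx e0 eP ?mem_head// mulr1.
rewrite ltNge (_ : e <= mdist _ _) ?mulr0//.
apply: eP.
  rewrite in_cons; apply/orP; right; apply/mapP.
  by exists j; rewrite ?mem_enum.
rewrite mdist_gt0; apply: contraNneq ji => xji; apply/eqP/f_inj.
by rewrite -!xE xji.
Qed.

(** * Closedness of the image and completeness of the module *)

Lemma hat_closed_span s0 : E 0 -> 0 < s0 -> (forall x, s0 <= h x) ->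
  closed (range hat_embed).
Proof.
move=> E0 s0_gt0 s0h u uR.
have [l ul] : exists l, val (u : hat_module) = comb l.
  have /asboolP /(_ 0 E0)[l ul] := valP (u : hat_module); exists l.
  apply/eqP; rewrite -subr_eq0; apply/negPn/negP => /(supp_le_ne0 ul).
  by rewrite ltxx.
(* [e] is at most [s0] and at most every positive critical value of each difference [u - hat p.2]
   with [p] in [l]. *)
have [e e0 eP] := pos_lower_bound
  (s0 :: flatten [seq critical ((-1, p.2) :: l) | p <- l]).
have [_ [x _ <-] ux] := closure_mdist uR e0.
(* As [e <= s0 <= h x], the ball of radius [e] about [x] avoids the added point; there [u] agrees
   with [hat x], which is 1. So some point [p.2] of [l] lies in this ball. *)
have xe : comb l x e != 0.
  rewrite -ul (hat_mdist_agree _ ux) /= /hat mdistxx e0.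
  by rewrite (le_trans _ (s0h x)) ?oner_neq0// eP ?mem_head.
have [p pl /andP[px _]] := comb_ne0 xe.
exists p.2 => //; apply/val_inj/esym/eqP; rewrite -subr_eq0.
have combl : val (u : hat_module) - hat p.2 = comb ((-1, p.2) :: l).
  by rewrite /comb big_cons -/(comb l) ul scaleN1r addrC.
(* If [u] differed from [hat p.2], the top radius of the difference would be critical, hence at
   least [e], whereas [u] is within less than [e] of [hat p.2]. *)
rewrite combl; apply/negPn/negP => /comb_top[s [sl [z sz] _]].
have up : mdist u (hat_embed p.2) < e.
  rewrite mdist_unorm -[_ - _](@subrKA _ (hat_embed x : hat_unm)).
  rewrite (le_lt_trans (unormD _ _))// gt_max -!mdist_unorm ux.
  by rewrite hat_embed_isometric metric_sym px.
have /andP[_ s_le] : 0 < s <= mdist u (hat_embed p.2).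
  by apply: hat_mdist_supp; rewrite combl; exact: sz.
have : e <= s.
  apply: eP; last exact: comb_gt0 sz.
  by rewrite in_cons; apply/orP; right; apply/flatten_mapP; exists p.
by rewrite leNgt (le_lt_trans s_le).
Qed.

(** The traces on [X] of the balls about [u] generate a Cauchy filter; its limit in [X] is at
    distance 0 from [u]. *)
Lemma hat_closed_complete : complete_space X -> closed (range hat_embed).
Proof.
move=> cX u uR.
pose G := filter_from [set e | 0 < e]
  (fun e => [set x | mdist u (hat_embed x) < e]).
have GF : ProperFilter G.
  apply: filter_from_proper => [|e e0].
    apply: filter_from_filter => [|e e' e0 e'0].
      by exists 1; exact: ltr01.
    exists (Num.min e e'); first by rewrite /= lt_min e0.
    by move=> x /=; rewrite lt_min => /andP.
  by have [_ [x _ <-] ux] := closure_mdist uR e0; exists x.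
have G_mdist e : 0 < e -> G [set x | mdist u (hat_embed x) < e].
  by move=> e0; exists e.
have [|x Gx] := cX G GF.
  apply: cauchy_exP => e e0; have e20 : 0 < e / 2 by rewrite divr_gt0.
  have [_ [x _ <-] ux] := closure_mdist uR e20.
  exists x, (e / 2) => // y /= uy; rewrite ballEmdist /= -hat_embed_isometric.
  rewrite (le_lt_trans (metric_triangle _ u _))// [e]splitr ltrD//.
  by rewrite metric_sym.
exists x => //; apply: mdist_positivity; apply/eqP.
rewrite eq_le mdist_ge0 andbT; apply/ler_addgt0Pl => e e0; rewrite addr0.
have e20 : 0 < e / 2 by rewrite divr_gt0.
move/metricType_numDomainType.fcvgrPdist_lt : Gx => /(_ _ e20) xG.
have [y [/= xy uy]] := filter_ex (filterI xG (G_mdist _ e20)).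
rewrite -hat_embed_isometric in xy; rewrite metric_sym in uy.
apply: le_trans (metric_triangle _ (hat_embed y) _) _; rewrite [e]splitr.
exact: lerD (ltW xy) (ltW uy).
Qed.

(** Elements at distance less than [r] agree at radius [r]. The limit [w] is therefore diagonal: its
    value at radius [r] is read off the centre [c r] of a ball of radius [r] belonging to the
    filter. *)
Lemma hat_unm_complete : E `<=` [set e | 0 < e] ->
  complete_space (metric_of hat_unm).
Proof.
move=> E_gt0 G GF /cauchyP Gc.
have uV : ultrametric (metric_of hat_unm).
  move=> u v w; rewrite !mdist_unorm -(@subrKA _ (w : hat_unm)).
  exact: unormD.
have /choice[c cP] e : exists u : metric_of hat_unm, 0 < e -> G (ball u e).
  have [e0|e0] := ltP 0 e.
    by have [u Gu] := Gc e e0; exists u.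
  by exists (0 : hat_unm).
pose w : F := fun y r => if 0 < r then val (c r : hat_module) y r else 0.
have wc e : 0 < e -> supp_le e (w - val (c e : hat_module)).
  move=> e0 y r; rewrite !fctE /w; case: (ltP 0 r) => /= [r0|r0].
    apply: contraR; rewrite -ltNge => er; rewrite subr_eq0.
    (* The two balls belong to the filter, hence meet; as [e < r], their centres [c e] and [c r] are
       at distance less than [r]. *)
    have [v []] := filter_ex (filterI (cP e e0) (cP r r0)).
    rewrite !ballEmdist /= => ev rv; apply/eqP/hat_mdist_agree.
    rewrite (le_lt_trans (uV _ _ v))// gt_max rv metric_sym.
    exact: lt_trans er.
  rewrite sub0r oppr_eq0 => /(approx_gt0 (valP (c e : hat_module))).
  by rewrite ltNge r0.
have wA : approx w.
  apply/asboolP => e Ee.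
  have /asboolP /(_ e Ee)[l cl] := valP (c e : hat_module).
  exists l; rewrite -(subrKA (val (c e : hat_module))).
  by apply: supp_leD => //; apply: wc; exact: E_gt0.
exists (exist approx w wA : metric_of hat_unm).
apply/metricType_numDomainType.fcvgrPdist_lt => e e0.
(* [wc] only bounds the distance from [w] to [c e] by [e] non-strictly; halving [e] makes the bound
   strict. *)
have e20 : 0 < e / 2 by rewrite divr_gt0.
apply: filterS (cP _ e20) => v; rewrite ballEmdist /= => cv.
have e2e : e / 2 < e by rewrite ltr_pdivrMr// ltr_pMr// ltr1n.
rewrite (le_lt_trans (uV _ _ (c (e / 2))))// gt_max (lt_trans cv)// andbT.
by rewrite (le_lt_trans _ e2e)//; apply/hat_mdist_leP; [exact: ltW|exact: wc].
Qed.

End hat_functions.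

(** * Distances to the added point, and the two choices of [E] *)

Lemma exists_radius (K : realType) (S : set K) (X : metricType K) (s0 : K) :
  ultrametric X -> valued_in S X -> S s0 -> 0 < s0 ->
  exists h : X -> K, [/\ forall x, S (h x), forall x, s0 <= h x,
    forall x y, h y <= Num.max (mdist x y) (h x) &
    forall x y, mdist x y <= Num.max (h x) (h y)].
Proof.
move=> hX hXS Ss0 s0_gt0.
(* On an empty space there is no base point [x0], and the conditions hold vacuously. *)
have [[x0 _]|noX] := pselect (exists x : X, True); last first.
  by exists (fun=> s0); split=> x; case: noX; exists x.
exists (fun y => Num.max (mdist x0 y) s0); split=> [x|x|x y|x y].
- by case: leP.
- by rewrite le_max lexx orbT.
- rewrite ge_max; apply/andP; split; last by rewrite !le_max lexx !orbT.
  rewrite (le_trans (hX _ _ x))// ge_max !le_max !lexx ?orbT//.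
- rewrite (le_trans (hX _ _ x0))// ge_max metric_sym.
  by rewrite !le_max !lexx ?orbT.
Qed.

Theorem theorem1p1 (K : realType) (S : set K) (hS : range_set S)
    (hS2 : exists s t : K, [/\ S s, S t & s <> t])
    (R : idomainType) (X : metricType K)
    (hX : ultrametric X) (hXS : valued_in S X) :
  (exists (V : ultraNormedModule K R) (I : X -> metric_of V),
      [/\ valued_in S (metric_of V), isometric_embedding I,
          closed (range I) & independent (range I : set V)]) /\
  (complete_space X ->
   exists (V : ultraNormedModule K R) (I : X -> metric_of V),
      [/\ valued_in S (metric_of V), isometric_embedding I,
          closed (range I), independent (range I : set V) &
          complete_space (metric_of V)]).
Proof.
(* Of two distinct elements of [S], at least one is nonzero, hence positive. *)
have [s0 Ss0 s0_gt0] : exists2 s0, S s0 & 0 < s0.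
  have [s [t [Ss St /eqP st]]] := hS2; have s_ge0 := hS.1 _ Ss.
  have [s0|s0] := eqVneq s 0; [exists t|exists s] => //.
    by rewrite lt_neqAle hS.1// andbT -s0.
  by rewrite lt_neqAle eq_sym s0.
have [h [hSh s0h h_max mdist_h]] := exists_radius hX hXS Ss0 s0_gt0.
have h_gt0 x : 0 < h x by exact: lt_le_trans (s0h x).
split=> [|cX].
  have E_small (r : K) : 0 < r -> exists2 e : K, [set 0] e & e < r by exists 0.
  exists (hat_unm R hX h_max hS hXS hSh E_small).
  exists (hat_embed R hX h_max hS hXS hSh E_small); split.
  - exact: hat_unm_valued.
  - exact: hat_embed_isometric.
  - exact: hat_closed_span s0_gt0 s0h.
  - exact: hat_independent.
have E_small (r : K) : 0 < r -> exists2 e : K, [set e | 0 < e] e & e < r.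
  move=> r0; exists (r / 2); rewrite /= ?divr_gt0//.
  by rewrite ltr_pdivrMr// ltr_pMr// ltr1n.
exists (hat_unm R hX h_max hS hXS hSh E_small).
exists (hat_embed R hX h_max hS hXS hSh E_small); split.
- exact: hat_unm_valued.
- exact: hat_embed_isometric.
- exact: hat_closed_complete.
- exact: hat_independent.
- exact: hat_unm_complete.
Qed.
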